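(* Let $M$ be a countable locally finite ultrahomogeneous structure such that algebraic closures of finite subsets of $M$ are finite. Then (at least) one of the following holds: \begin{enumerate} \item $M$ has the Hrushovski property, \item $M$ does not have the $1$-Hrushovski property, \item there exists $n\geq 1$ such that no topological $n$-similarity class in $\mathrm{Aut}(M)$ is comeager in $\mathrm{Aut}(M)^n$ (in particular, $\mathrm{Aut}(M)$ does not have ample generics). \end{enumerate}
   Context: A structure is a set with relations and functions; it is locally finite if all its finitely generated substructures are finite. $M$ is ultrahomogeneous if every isomorphism between finite substructures of $M$ extends to an automorphism of $M$. $\mathrm{Age}(M)$ is the class of all finite structures embeddable in $M$. $\mathrm{Aut}(M)$ carries the pointwise convergence topology ($M$ discrete), making it a Polish group. For finite $A\subseteq M$, $\mathrm{Aut}_A(M)$ is the pointwise stabilizer of $A$ in $\mathrm{Aut}(M)$, and the algebraic closure of $A$ is the set of all elements of $M$ whose orbit under the evaluation action of $\mathrm{Aut}_A(M)$ is finite. For $n\ge 1$, $M$ has the $n$-Hrushovski property if for every $A\in\mathrm{Age}(M)$ and every tuple $(p_1,\ldots,p_n)$ of partial automorphisms of $A$ (isomorphisms between substructures of $A$) there is $B\in\mathrm{Age}(M)$ with $A\subseteq B$ (as a substructure) such that every $p_i$ extends to an automorphism of $B$. $M$ has the Hrushovski property if it has the $n$-Hrushovski property for all $n\ge 1$. For an $n$-tuple $\bar f=(f_1,\ldots,f_n)$ in a topological group $G$, $\langle\bar f\rangle$ is the subgroup generated by $\{f_1,\ldots,f_n\}$. The topological $n$-similarity class of $\bar f$ is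 the set of all $\bar g=(g_1,\ldots,g_n)\in G^n$ such that the map $f_i\mapsto g_i$ extends (necessarily uniquely) to a bi-continuous group isomorphism between $\langle\bar f\rangle$ and $\langle\bar g\rangle$, taken with the subspace topologies. A Polish group $G$ has ample generics if for every $n\geq1$ the diagonal conjugation action $g.(h_1,\ldots,h_n)=(gh_1g^{-1},\ldots,gh_ng^{-1})$ of $G$ on $G^n$ has a comeager orbit. *)

(* Defs.v *)
From HB Require Import structures.
From mathcomp Require Import all_boot.
From mathcomp Require Import all_classical.
From mathcomp Require Import topology.

Set Implicit Arguments.
Unset Strict Implicit.
Unset Printing Implicit Defensive.

Local Open Scope classical_set_scope.
Local Open Scope group_scope.

(* First-order structures. Symbols of arity 0 are allowed (in particular a
   function symbol of arity 0 is a constant), and so are empty structures. *)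

Record language := Language {
  rel_symb : Type;
  fun_symb : Type;
  rel_arity : rel_symb -> nat;
  fun_arity : fun_symb -> nat }.

Record structure (L : language) := Structure {
  carrier :> Type;
  interp_rel : forall r : rel_symb L, ('I_(rel_arity r) -> carrier) -> Prop;
  interp_fun : forall s : fun_symb L,
    ('I_(fun_arity s) -> carrier) -> carrier }.

Arguments interp_rel {L} _ r _.
Arguments interp_fun {L} _ s _.

Section Structures.
Context {L : language}.
Implicit Types A B M : structure L.

Definition substructure M (D : set M) : Prop :=
  forall (s : fun_symb L) (x : 'I_(fun_arity s) -> M),
    (forall i, D (x i)) -> D (interp_fun M s x).

Definition generated_substructure M (S : set M) : set M :=
  smallest (@substructure M) S.

Definition locally_finite M : Prop :=
  forall S : set M, finite_set S -> finite_set (generated_substructure S).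

Definition preserves_on A B (D : set A) (f : A -> B) : Prop :=
  (forall (r : rel_symb L) (x : 'I_(rel_arity r) -> A),
     (forall i, D (x i)) -> (interp_rel A r x <-> interp_rel B r (f \o x))) /\
  (forall (s : fun_symb L) (x : 'I_(fun_arity s) -> A),
     (forall i, D (x i)) -> f (interp_fun A s x) = interp_fun B s (f \o x)).

Definition embedding A B (f : A -> B) : Prop :=
  injective f /\ preserves_on setT f.

Definition automorphism M (f : M -> M) : Prop :=
  bijective f /\ preserves_on setT f.

(* [p] restricts to an isomorphism from the substructure [D] onto the
   substructure [E]; the values of [p] outside [D] are irrelevant. *)
Definition partial_automorphism M (D E : set M) (p : M -> M) : Prop :=
  [/\ substructure D, substructure E, set_bij D E p & preserves_on D p].

Record aut M := Aut {
  aut_fun :> M -> M;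
  aut_funP : automorphism aut_fun }.

Definition ultrahomogeneous M : Prop :=
  forall (D E : set M) (p : M -> M),
    finite_set D -> finite_set E -> partial_automorphism D E p ->
    exists g : aut M, forall x, D x -> g x = p x.

Definition in_age M A : Prop :=
  finite_set [set: A] /\ exists e : A -> M, embedding e.

Definition pointwise_stabilizer M (A : set M) : set (aut M) :=
  [set g : aut M | forall a, A a -> g a = a].

Definition algebraic_closure M (A : set M) : set M :=
  [set x | finite_set [set (g : aut M) x | g in pointwise_stabilizer A]].

(* The inclusion of [A] in [B] as a substructure is rendered by an
   embedding [e]. *)
Definition n_hrushovski M (n : nat) : Prop :=
  forall A, in_age M A ->
  forall (D E : 'I_n -> set A) (p : 'I_n -> A -> A),
    (forall i, partial_automorphism (D i) (E i) (p i)) ->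
  exists B (e : A -> B), [/\ in_age M B, embedding e &
    forall i, exists g : aut B, forall x, D i x -> g (e x) = e (p i x)].

Definition hrushovski M : Prop :=
  forall n, (1 <= n)%N -> n_hrushovski M n.

End Structures.

Section Category.
Context {T : topologicalType}.

Definition nowhere_dense (A : set T) : Prop := interior (closure A) = set0.

Definition meager (A : set T) : Prop :=
  exists2 N : nat -> set T, (forall k, nowhere_dense (N k)) & A = \bigcup_k N k.

Definition comeager (A : set T) : Prop := meager (~` A).

End Category.

HB.mixin Record isTopologicalGroup G of Group G & Topological G := {
  mulg_continuous : continuous (fun xy : G * G => xy.1 * xy.2);
  invg_continuous : continuous (fun x : G => x^-1) }.

#[short(type="topGroupType")]
HB.structure Definition TopologicalGroup :=
  {G of Group G & Topological G & isTopologicalGroup G}.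

Section TopologicalGroups.
Context {G : topGroupType}.

Definition subgroup (H : set G) : Prop :=
  [/\ H 1, forall x y, H x -> H y -> H (x * y) & forall x, H x -> H x^-1].

Definition generated_subgroup n (f : 'I_n -> G) : set G :=
  smallest subgroup (range f).

Definition bicontinuous_isomorphism (H K : set G) (phi : G -> G) : Prop :=
  [/\ set_bij H K phi,
      (forall x y, H x -> H y -> phi (x * y) = phi x * phi y),
      {within H, continuous phi} &
      exists2 psi : G -> G,
        (forall x, H x -> psi (phi x) = x) & {within K, continuous psi}].

Definition similarity_class n (f : 'I_n -> G) : set {ptws 'I_n -> G} :=
  [set g | exists2 phi : G -> G,
     bicontinuous_isomorphism (generated_subgroup f) (generated_subgroup g) phi
     & forall i, phi (f i) = g i].

Definition diagonal_orbit n (h : 'I_n -> G) : set {ptws 'I_n -> G} :=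
  [set k | exists g : G, k = (fun i => g * h i * g^-1)].

End TopologicalGroups.

Definition ample_generics (G : topGroupType) : Prop :=
  forall n, (1 <= n)%N ->
    exists h : 'I_n -> G, comeager (diagonal_orbit h).

(* Aut(M) as a topological group: composition, and pointwise convergence
   with M discrete. *)
Section AutomorphismGroup.
Context {L : language} {M : structure L}.

Lemma aut_eq (g h : aut M) : (forall x, g x = h x) -> g = h.
Proof.
case: g h => [g Pg] [h Ph] /= /funext gh; subst h.
by congr Aut; exact: Prop_irrelevance.
Qed.

Lemma automorphism_id : @automorphism L M id.
Proof. by split; [exists id | split]. Qed.

Lemma automorphism_comp (g h : aut M) : automorphism (g \o h).
Proof.
case: g h => [g [bg [rg fg]]] [h [bh [rh fh]]] /=.
split; first exact: bij_comp.
split=> [r x _|s x _] /=; last by rewrite fh // fg.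
by rewrite rh // rg.
Qed.

Lemma aut_inverse (g : aut M) :
  {h : aut M | cancel g h /\ cancel h g}.
Proof.
apply/cid; case: g => [g [[h gK hK] [rg fg]]] /=.
have gh n (x : 'I_n -> M) : g \o (h \o x) = x by apply/funext => i /=.
have Ph : automorphism h.
  split; first by exists g.
  split=> [r x _|s x _].
    by have [p q] := rg r (h \o x) (fun=> I); move: p q; rewrite gh.
  by apply: (can_inj gK); rewrite hK fg // gh.
by exists (Aut Ph).
Qed.

Definition aut_one : aut M := Aut automorphism_id.
Definition aut_mul (g h : aut M) : aut M := Aut (automorphism_comp g h).
Definition aut_inv (g : aut M) : aut M := projT1 (aut_inverse g).

Lemma aut_invK (g : aut M) : cancel g (aut_inv g).
Proof. by rewrite /aut_inv; case: aut_inverse => h []. Qed.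

Lemma aut_invVK (g : aut M) : cancel (aut_inv g) g.
Proof. by rewrite /aut_inv; case: aut_inverse => h []. Qed.

HB.instance Definition _ := gen_eqMixin (aut M).
HB.instance Definition _ := gen_choiceMixin (aut M).

Lemma aut_mulA : associative aut_mul.
Proof. by move=> f g h; exact: aut_eq. Qed.
Lemma aut_mul1 : left_id aut_one aut_mul.
Proof. by move=> g; exact: aut_eq. Qed.
Lemma aut_1mul : right_id aut_one aut_mul.
Proof. by move=> g; exact: aut_eq. Qed.
Lemma aut_mulV : left_inverse aut_one aut_inv aut_mul.
Proof. by move=> g; apply: aut_eq => x /=; rewrite aut_invK. Qed.
Lemma aut_Vmul : right_inverse aut_one aut_inv aut_mul.
Proof. by move=> g; apply: aut_eq => x /=; rewrite aut_invVK. Qed.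

HB.instance Definition _ := isGroup.Build (aut M)
  aut_mulA aut_mul1 aut_1mul aut_mulV aut_Vmul.

Definition aut_ptws (g : aut M) : {ptws M -> discrete_topology {classic M}} :=
  aut_fun g.

HB.instance Definition _ :=
  Topological.copy (aut M) (initial_topology aut_ptws).

Lemma aut_near (g : aut M) (x : M) : \forall h \near g, (h : aut M) x = g x.
Proof.
pose V := [set f : {ptws M -> discrete_topology {classic M}} | f x = g x].
suff gV : nbhs (aut_ptws g) V by exact: (initial_continuous gV).
have /cvg_sup/(_ x) : nbhs (aut_ptws g) --> aut_ptws g by exact: cvg_id.
apply; exists V; split=> //.
by exists [set g x : discrete_topology {classic M}] => //; exact: discrete_open.
Qed.

Lemma aut_cvg (F : set_system (aut M)) (g : aut M) : Filter F ->
  (forall x, \forall h \near F, (h : aut M) x = g x) -> F --> g.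
Proof.
move=> FF near_g A [B [[C Cop <-] Cg BA]].
apply: filterS BA _; have : nbhs (aut_ptws g) C by exact: open_nbhs_nbhs.
have : (aut_ptws @ F) --> aut_ptws g.
  apply/cvg_sup => x D [E [[U _ <-] Ug ED]].
  by apply: filterS (near_g x) => h hx; apply: ED; rewrite /= /aut_ptws hx.
exact.
Qed.

Lemma aut_mul_continuous :
  continuous (fun gh : aut M * aut M => gh.1 * gh.2).
Proof.
move=> [g h] /=; apply: aut_cvg => x.
exists ([set g' : aut M | g' (h x) = g (h x)], [set h' : aut M | h' x = h x]).
  by split; exact: aut_near.
by move=> [g' h'] [/= g'h h'x]; rewrite h'x.
Qed.

Lemma aut_inv_continuous : continuous (fun g : aut M => g^-1).
Proof.
move=> g; apply: (@aut_cvg (_ @ nbhs g)) => x.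
apply: filterS (aut_near g (aut_inv g x)) => h hx.
change (aut_inv h x = aut_inv g x).
by rewrite -[RHS](aut_invK h) hx aut_invVK.
Qed.

HB.instance Definition _ := isTopologicalGroup.Build (aut M)
  aut_mul_continuous aut_inv_continuous.

End AutomorphismGroup.

(* Main.v *)
Require Import Defs.
From mathcomp Require Import all_boot finmap.
From mathcomp Require Import all_classical.
From mathcomp Require Import topology.

(** Suppose that [M] has the 1-Hrushovski property but that the n-Hrushovski
property fails for some [n], necessarily with [1 < n]; then no topological
n-similarity class is comeager. Suppose that the class of [f] is comeager. A
basic open set of n-tuples of automorphisms is a cylinder: it prescribes the
tuple on a finite subset of [M].

By the 1-Hrushovski property and Baire category, the class of [f] contains a
tuple [g] whose coordinate [g i] has only finite cycles
([comeager_meets_finite_orbits]). The powers of [g i] with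
exponent [k`!] then tend to 1, so positive exponents [e m] can be chosen for
which the conjugates [w^-1 * x_i ^ e m * w], evaluated at [g], tend to 1 as [m]
grows, uniformly over the words [w] of length at most [m]. Convergence of
words to 1 is an invariant of topological similarity, so the same exponents
serve for all tuples of the class ([similarity_class_conjugate_powers]).

The failure of the n-Hrushovski property gives a cylinder in which every tuple
generates a group with an infinite orbit through a fixed finite set [S]: if all
these orbits were finite, the substructure that they generate would be a finite
structure solving the extension problem
([not_hrushovski_infinite_orbits]).

By Baire category, some smaller cylinder and some [K] are such that, for all
its tuples, all [m >= K] and all [w] of length at most [m], the conjugate above
fixes [S] pointwise. This is impossible ([escape]): the orbit of some [a] in
[S] is infinite, hence leaves the finite set of points whose behaviour the
cylinder controls, namely the algebraic closure of its base. Some word [w]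
carries [a] to a point outside this closure, where the tuple can be modified
inside the cylinder so that a given positive power of its coordinate [i] does
not fix that point. The last step before leaving the closure may constrain one
generator at the exit point; a second generator, available since [1 < n], is
used to move on freely.

Ample generics are excluded because diagonal conjugacy classes lie in
similarity classes ([diagonal_orbit_similar]). *)

Set Implicit Arguments.
Unset Strict Implicit.
Unset Printing Implicit Defensive.

Local Open Scope classical_set_scope.

(** * Finite sets and iterates *)

Lemma filter_finite_forall {T I : Type} (F : set_system T) (B : set I)
    (P : I -> set T) :
  Filter F -> finite_set B -> (forall i, B i -> F (P i)) ->
  \forall x \near F, forall i, B i -> P i x.
Proof.
move=> FF /(@finite_fsetP {classic I})[X BX] FP.
have : F (\bigcap_(i in [set` X]) P i).
  by apply: filter_bigI => i Xi; apply: FP; rewrite BX.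
by apply: filterS => x Px i; rewrite BX; apply: Px.
Qed.

Lemma finite_set_below {T : Type} (r : T -> nat) (m : nat) :
  injective r -> finite_set [set x | (r x <= m)%N].
Proof.
move=> r_inj; rewrite (_ : [set _ | _] = r @^-1` `I_m.+1) //.
by apply: finite_preimage (finite_II _) => x y _ _; exact: r_inj.
Qed.

Lemma injective_iter_periodic {T : Type} (A : set T) (f : T -> T) (x : T) :
  finite_set A -> injective f -> (forall k, A (iter k f x)) ->
  exists2 N, (0 < N)%N & iter N f x = x.
Proof.
move=> Afin f_inj Af; apply: contrapT => noN; apply: infinite_nat.
have it_inj : injective (fun k => iter k f x).
  move=> k l; wlog le_kl : k l / (k <= l)%N.
    move=> wl e; case: (leqP k l) => [|/ltnW] le; first exact: wl.
    by apply/esym/wl.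
  rewrite -(subnKC le_kl) iterD.
  move: (l - k)%N => d; elim: k {le_kl} => [|k IH] /=; last first.
    by move=> /f_inj/IH e; rewrite addSn -e.
  by case: d => [|d] //= e; case: noN; exists d.+1.
rewrite (_ : setT = (fun k => iter k f x) @^-1` A); last first.
  by apply/seteqP; split=> k // _; exact: Af.
by apply: finite_preimage Afin => k l _ _; exact: it_inj.
Qed.

(** * Words in a tuple of group elements *)

Section Words.
Local Open Scope group_scope.
Context {G : topGroupType} {n : nat}.
Implicit Types (f : 'I_n -> G) (w : seq ('I_n * bool)).

(** The letter [(i, true)] stands for the generator of index [i] and [(i, false)]
for its inverse. In a group of automorphisms the last letter of a word acts
first, so that adding letters in front prolongs the path of a point. *)
Definition letter_value f (s : 'I_n * bool) : G :=
  if s.2 then f s.1 else (f s.1)^-1.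

Definition word_value f w : G := foldr (fun s x => letter_value f s * x) 1 w.

Definition word_inverse w := rev [seq (s.1, ~~ s.2) | s <- w].

Lemma word_value_cat f w1 w2 :
  word_value f (w1 ++ w2) = word_value f w1 * word_value f w2.
Proof.
by elim: w1 => [|s w1 IH] /=; rewrite ?mul1g // -[LHS]/(_ * _) IH mulgA.
Qed.

Lemma word_value_inverse f w :
  word_value f (word_inverse w) = (word_value f w)^-1.
Proof.
elim: w => [|[i b] w IH]; first by rewrite /= invg1.
rewrite /word_inverse map_cons rev_cons -cats1 word_value_cat.
rewrite -/(word_inverse w) IH /= mulg1 invgM; congr (_ * _).
by case: b; rewrite /letter_value //= invgK.
Qed.

Lemma word_value_generated f w : generated_subgroup f (word_value f w).
Proof.
move=> H [[H1 HM HV] fH]; elim: w => [|[i b] w IH] //=.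
by apply: HM => //; case: b; rewrite /letter_value /=; [|apply: HV];
  apply: fH; exists i.
Qed.

Lemma bicontinuous_word_value f g (phi : G -> G) w :
  bicontinuous_isomorphism (generated_subgroup f) (generated_subgroup g) phi ->
  (forall i, phi (f i) = g i) -> phi (word_value f w) = word_value g w.
Proof.
move=> [_ phiM _ _] phif.
have gen1 : generated_subgroup f 1 by exact: (@word_value_generated f [::]).
have genf i : generated_subgroup f (f i) by move=> H [_]; apply; exists i.
have genV x : generated_subgroup f x -> generated_subgroup f x^-1.
  by move=> Hx H HH; have [[_ _ HV] _] := HH; apply: HV; exact: Hx.
have phi1 : phi 1 = 1.
  by apply: (mulgI (phi 1)); rewrite -phiM // !mulg1.
have phiV x : generated_subgroup f x -> phi x^-1 = (phi x)^-1.
  move=> Hx; apply: (mulgI (phi x)).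
  by rewrite -phiM ?mulgV //; exact: genV.
elim: w => [|[i b] w IH] //=.
rewrite phiM ?IH; last exact: word_value_generated.
  by case: b; rewrite /letter_value /= ?phiV // phif.
by case: b; rewrite /letter_value /=; [|apply: genV].
Qed.

End Words.

(** * Cylinders of tuples of automorphisms *)

Section Cylinders.
Context {L : language} {M : structure L} {n : nat}.
Local Notation tuple_space := {ptws 'I_n -> aut M}.
Implicit Types (f g h : 'I_n -> aut M) (B : set M) (w : seq ('I_n * bool)).

Definition cylinder h B : set ('I_n -> aut M) :=
  [set g | forall i x, B x -> g i x = h i x].

Lemma cylinder_refl h B : cylinder h B h. Proof. by []. Qed.

Lemma subset_cylinder h g B B' :
  cylinder h B g -> B `<=` B' -> cylinder g B' `<=` cylinder h B.
Proof. by move=> hg BB' k gk i x Bx; rewrite gk ?hg //; exact: BB'. Qed.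

(** The product topology over ['I_n] and the topology of pointwise convergence
together have the cylinders over finite sets as a base. *)
Lemma nbhs_cylinderP h (A : set tuple_space) :
  nbhs (h : tuple_space) A <->
  exists2 B, finite_set B & cylinder h B `<=` A.
Proof.
split=> [|[B Bfin] BA].
  (* It is enough that the filter generated by the cylinders converges. *)
  pose F : set_system tuple_space := filter_from finite_set (cylinder h).
  have FF : Filter F.
    apply: filter_from_filter; first by exists set0; exact: finite_set0.
    move=> B1 B2 fin1 fin2; exists (B1 `|` B2); first by rewrite finite_setU.
    by move=> g hg; split=> i x Bx; apply: hg; [left|right].
  suff : F --> (h : tuple_space) by apply.
  apply/cvg_sup => i D [E [[U Uop <-] Uh ED]].
  have FU : (fun g => g i) @ F --> h i.
    apply: aut_cvg => x; exists [set x]; first exact: finite_set1.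
    by move=> g hg; exact: hg.
  apply: filterS ED _; apply: FU; apply: open_nbhs_nbhs.
  by split; [exact: Uop|exact: Uh].
apply: (@filterS _ (nbhs (h : tuple_space)) _ _ _ BA).
apply: (@filter_forall _ _ (fun i (g : tuple_space) =>
  forall x, B x -> g i x = h i x) _ (nbhs_filter (h : tuple_space))) => i.
apply: (filter_finite_forall (P := fun x (g : tuple_space) =>
  g i x = h i x) (nbhs_filter (h : tuple_space)) Bfin) => x _.
exact: (@proj_continuous _ (fun=> aut M) i h _ (aut_near (h i) x)).
Qed.

(** The image of a point under a word only depends on the values of the tuple
along the path of the point, which is finite. *)
Lemma word_value_local f w x :
  exists2 B, finite_set B &
    forall g, cylinder f B g -> word_value g w x = word_value f w x.
Proof.
elim: w => [|[i b] w [B Bfin IH]]; first by exists set0.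
pose y := letter_value f (i, b) (word_value f w x).
exists (B `|` [set word_value f w x; y]).
  by rewrite finite_setU; split=> //; exact: finite_set2.
move=> g fg.
rewrite -[LHS]/(letter_value g (i, b) (word_value g w x)) IH; last first.
  by move=> j z Bz; apply: fg; left.
change (letter_value g (i, b) (word_value f w x) = y).
case: b @y fg; rewrite /letter_value /= => fg.
  by apply: fg; right; left.
set y := (X in _ = X) in fg *.
change (aut_inv (g i) (word_value f w x) = y).
apply: (can_inj (aut_invK (g i))); rewrite aut_invVK fg; last by right; right.
by rewrite /y; exact/esym/aut_invVK.
Qed.

Lemma nowhere_dense_cylinder (A : set tuple_space) h B :
  nowhere_dense A -> finite_set B ->
  exists g B', [/\ finite_set B', cylinder g B' `<=` cylinder h B &
    cylinder g B' `<=` ~` A].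
Proof.
move=> A0 Bfin; apply: contrapT => noA.
suff : interior (closure A) h by rewrite A0.
apply/nbhs_cylinderP; exists B => // g hg; apply: contrapT => ncA; apply: noA.
have /nbhs_cylinderP[B' B'fin B'A] : nbhs (g : tuple_space) (~` A).
  apply: contrapT => ngA; apply: ncA => V gV.
  apply: contrapT => AV; apply: ngA; apply: filterS gV => k Vk Ak.
  by apply: AV; exists k.
exists g, (B `|` B'); split; first by rewrite finite_setU.
  by apply: subset_cylinder => // x; left.
by apply: subset_trans B'A; apply: subset_cylinder => // x; right.
Qed.
End Cylinders.

(** * Baire category for cylinders *)

(** Symbols have finite arity, so being a homomorphism is a condition on finitely
many points at a time; only surjectivity is not of this kind. *)
Lemma local_automorphism {L : language} {M : structure L} (r : M -> nat)
    (h : nat -> aut M) (g : M -> M) :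
  (forall k x, (r x < k)%N -> h k x = g x) ->
  (forall y, exists x, g x = y) -> automorphism g.
Proof.
move=> hg g_surj.
have ltmax m (x : 'I_m -> M) k i : (r (x i) < (maxn k (\max_j r (x j))).+1)%N.
  by rewrite ltnS leq_max leq_bigmax orbT.
have g_inj : injective g.
  move=> x y gxy; pose k := (maxn (r x) (r y)).+1.
  apply: (can_inj (aut_invK (h k))).
  by rewrite !hg ?gxy // ltnS ?leq_maxl // leq_maxr.
split.
  have [g' gK] := choice g_surj.
  by exists g' => // x; apply: g_inj; rewrite gK.
split=> [R x _|s x _].
  pose k := (maxn 0 (\max_j r (x j))).+1.
  have [_ [+ _]] := aut_funP (h k) => /(_ R x (fun=> I)).
  rewrite (_ : h k \o x = g \o x) //.
  by apply/funext => i /=; apply: hg; exact: ltmax.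
pose k := (maxn (r (interp_fun M s x)) (\max_j r (x j))).+1.
have [_ [_]] := aut_funP (h k) => /(_ s x (fun=> I)).
rewrite hg ?ltnS ?leq_maxl // (_ : h k \o x = g \o x) //.
by apply/funext => i /=; apply: hg; exact: ltmax.
Qed.

Section Baire.
Context {L : language} {M : structure L} {n : nat}.
Implicit Types (f g h : 'I_n -> aut M) (B : set M).

(** Baire category theorem, by fusion. A decreasing sequence of cylinders is built
whose bases exhaust [M], so that the tuples converge pointwise. The limit is
surjective because the bases are also made to contain the inverse images of
more and more points. *)
Lemma cylinder_Baire (r : M -> nat) (D : nat -> set ('I_n -> aut M)) h B :
  injective r -> finite_set B ->
  (forall k g B', finite_set B' -> cylinder g B' `<=` cylinder h B ->
     exists g' B'', [/\ finite_set B'', cylinder g' B'' `<=` cylinder g B' &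
                        cylinder g' B'' `<=` D k]) ->
  exists2 g, cylinder h B g & forall k, D k g.
Proof.
move=> r_inj Bfin Ddense.
pose refines k (p q : ('I_n -> aut M) * set M) := [/\
  cylinder q.1 q.2 `<=` cylinder p.1 p.2, p.2 `<=` q.2,
  cylinder q.1 q.2 `<=` D k, (forall x, (r x <= k)%N -> q.2 x) &
  (forall i x, (r x <= k)%N -> q.2 (aut_inv (q.1 i) x))].
pose cond (p : ('I_n -> aut M) * set M) :=
  finite_set p.2 /\ cylinder p.1 p.2 `<=` cylinder h B.
have step (kp : nat * {p | cond p}) :
    exists q : {p | cond p}, refines kp.1 (sval kp.2) (sval q).
  case: kp => k [[g C] [/= Cfin gC]].
  have [g' [C' [C'fin g'g g'D]]] := Ddense k g C Cfin gC.
  pose K := [set x | (r x <= k)%N].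
  have Kfin : finite_set K by exact: finite_set_below.
  pose E := C `|` C' `|` K `|` \bigcup_(i in setT) (aut_inv (g' i) @` K).
  have Efin : finite_set E.
    rewrite !finite_setU; split=> //.
    by apply: bigcup_finite => [|i _]; [exact: finite_finset|exact: finite_image].
  have g'E : cylinder g' E `<=` cylinder g' C'.
    by apply: subset_cylinder => // x ?; left; left; right.
  have condE : cond (g', E).
    by split=> //; apply: subset_trans g'E _; exact: subset_trans gC.
  exists (exist _ _ condE); split=> //=.
  - exact: subset_trans g'g.
  - by move=> x ?; left; left; left.
  - exact: subset_trans g'D.
  - by move=> x ?; left; right.
  - by move=> i x ?; right; exists i => //; exists x.
have [F Fstep] := choice step.
have cond0 : cond (h, B) by split.
(* Fusion sequence, with the [k]-th step taken inside [D k]. *)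
pose s := fix s k := if k is k'.+1 then F (k', s k') else exist _ _ cond0.
have s_refines k : refines k (sval (s k)) (sval (s k.+1)) by exact: (Fstep (k, s k)).
pose H k := (sval (s k)).1; pose C k := (sval (s k)).2.
have mono k l : (k <= l)%N ->
    cylinder (H l) (C l) `<=` cylinder (H k) (C k) /\ C k `<=` C l.
  move/subnKC <-; elim: (l - k)%N => [|d [IH1 IH2]]; first by rewrite addn0; split.
  rewrite addnS; have [s1 s2 _ _ _] := s_refines (k + d)%N.
  by split; [exact: (subset_trans s1 IH1)|exact: (subset_trans IH2 s2)].
have C_below k x : (r x < k)%N -> C k x.
  by case: k => // k; have [_ _ _ + _] := s_refines k; apply.
(* From the stage [(r x).+1] on, the point [x] lies in all the bases. *)
pose G i x := H (r x).+1 i x.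
have HG k i x : C k x -> H k i x = G i x.
  move=> Cx; rewrite /G.
  case: (leqP k (r x).+1) => le.
    by have [sub _] := mono _ _ le; rewrite (sub _ (@cylinder_refl _ _ _ _ _)).
  have [sub _] := mono _ _ (ltnW le).
  by rewrite (sub _ (@cylinder_refl _ _ _ _ _)) //; exact: C_below.
have G_aut i : automorphism (G i).
  apply: (@local_automorphism _ _ r (fun k => H k i)).
    by move=> k x xk; apply: HG; exact: C_below.
  move=> y; exists (aut_inv (H (r y).+1 i) y).
  rewrite -(HG (r y).+1) ?aut_invVK //.
  by have [_ _ _ _] := s_refines (r y); apply.
pose g i := Aut (G_aut i).
have Hg k : cylinder (H k) (C k) g by move=> i x Cx; rewrite HG.
exists g; first exact: (Hg 0%N).
by move=> k; have [_ _ + _ _] := s_refines k; apply; exact: (Hg k.+1).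
Qed.

End Baire.

(** * Convergence of words along a similarity class *)

Section Similarity.
Local Open Scope group_scope.
Context {L : language} {M : structure L} {n : nat}.
Implicit Types (f g h : 'I_n -> aut M).

Lemma nbhs_aut_stabilizer (u : aut M) (A : set (aut M)) :
  nbhs u A -> exists2 B, finite_set B &
    forall v : aut M, (forall x, B x -> v x = u x) -> A v.
Proof.
pose F : set_system (aut M) :=
  filter_from finite_set (fun B => [set v : aut M | forall x, B x -> v x = u x]).
have FF : Filter F.
  apply: filter_from_filter; first by exists set0; exact: finite_set0.
  move=> B1 B2 fin1 fin2; exists (B1 `|` B2); first by rewrite finite_setU.
  by move=> g hg; split=> x Bx; apply: hg; [left|right].
suff Fu : F --> u by move=> /Fu.
apply: aut_cvg => x; exists [set x]; first exact: finite_set1.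
by move=> v; exact.
Qed.

(** This is the continuity at 1 of a map that matches the words in two tuples. *)
Lemma continuous_word_fix f g (phi : aut M -> aut M) (a : M) :
  {within generated_subgroup f, continuous phi} ->
  (forall w, phi (word_value f w) = word_value g w) ->
  exists2 B, finite_set B & forall w,
    (forall x, B x -> word_value f w x = x) -> word_value g w a = a.
Proof.
move=> /subspace_continuousP phi_cont phi_word.
have gen1 : generated_subgroup f 1 by exact: (@word_value_generated _ _ f [::]).
have := phi_cont 1 gen1 _ (aut_near (phi 1) a).
move=> /nbhs_aut_stabilizer[B Bfin BP]; exists B => // w fixB.
rewrite -phi_word (BP _ fixB) ?(phi_word [::]) //.
exact: word_value_generated.
Qed.

(** Both tuples are compared with [f]: first through the inverse of the isomorphism
for [g], then through the isomorphism for [g']. *)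
Lemma similarity_class_word_fix f g g' (a : M) :
  similarity_class f g -> similarity_class f g' ->
  exists2 B, finite_set B & forall w,
    (forall x, B x -> word_value g w x = x) -> word_value g' w a = a.
Proof.
move=> [phi isophi phif] [phi' isophi' phif'].
have phiw w : phi (word_value f w) = word_value g w.
  exact: bicontinuous_word_value.
have phiw' w : phi' (word_value f w) = word_value g' w.
  exact: bicontinuous_word_value.
have [_ _ _ [psi psiK psi_cont]] := isophi.
have psiw w : psi (word_value g w) = word_value f w.
  by rewrite -phiw psiK //; exact: word_value_generated.
have [_ _ phi'_cont _] := isophi'.
have [B Bfin BP] := continuous_word_fix a phi'_cont phiw'.
have /choice[C CP] x : exists C : set M, finite_set C /\ forall w,
    (forall y, C y -> word_value g w y = y) -> word_value f w x = x.
  by have [C ? ?] := continuous_word_fix x psi_cont psiw; exists C.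
exists (\bigcup_(x in B) C x).
  by apply: bigcup_finite => // x _; have [] := CP x.
move=> w fixC; apply: BP => x Bx; have [_] := CP x; apply=> y Cy.
by apply: fixC; exists x.
Qed.

Lemma word_value_nseq f i N x :
  word_value f (nseq N (i, true)) x = iter N (f i) x.
Proof. by elim: N => [|N /= <-]. Qed.

Definition conjugate_power i N w : seq ('I_n * bool) :=
  word_inverse w ++ nseq N (i, true) ++ w.

Lemma conjugate_power_fix f i N w a :
  word_value f (conjugate_power i N w) a = a <->
  iter N (f i) (word_value f w a) = word_value f w a.
Proof.
rewrite /conjugate_power !word_value_cat word_value_inverse.
rewrite -word_value_nseq; set u := word_value f w; set v := word_value f _.
rewrite -[X in X = a]/(aut_inv u (v (u a))).
split=> [va|->]; last exact: aut_invK.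
by rewrite -{2}va aut_invVK.
Qed.

Definition finite_orbits (u : aut M) : Prop :=
  forall x, exists2 N, (0 < N)%N & iter N u x = x.

(** The words of length at most [m] move the points of rank at most [m] to finitely
many points, each of which has a finite cycle under [f i]; the factorial of a
large number is a multiple of all the lengths of these cycles. *)
Lemma uniform_exponents f i (r : M -> nat) :
  injective r -> finite_orbits (f i) ->
  exists N : nat -> nat, (forall m, 0 < N m)%N /\
    forall m w x, (size w <= m)%N -> (r x <= m)%N ->
      word_value f (conjugate_power i (N m) w) x = x.
Proof.
move=> r_inj fin_orb.
suff /choice[N NP] m : exists N, (0 < N)%N /\
    forall w x, (size w <= m)%N -> (r x <= m)%N ->
      word_value f (conjugate_power i N w) x = x.
  by exists N; split=> [m|m]; have [] := NP m.
pose E := [set word_value f (t : {bseq m of 'I_n * bool}) x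
  | t in [set: {bseq m of 'I_n * bool}] & x in [set x | (r x <= m)%N]].
have Efin : finite_set E.
  by apply: finite_image2; [exact: finite_finset|exact: finite_set_below].
have : \forall k \near \oo, forall y, E y -> iter k`! (f i) y = y.
  apply: (filter_finite_forall (P := fun y k => iter k`! (f i) y = y)) => // y _.
  have [N N0 Ny] := fin_orb y.
  exists N => // k /= Nk.
  have /dvdnP[q ->] : N %| k`! by apply: dvdn_fact; rewrite N0.
  by elim: q => // q IH; rewrite mulSn iterD IH.
case=> k _ /(_ k (leqnn k)) kP; exists k`!; split; first exact: fact_gt0.
move=> w x wm xm; apply/conjugate_power_fix; apply: kP.
by exists (Bseq wm) => //; exists x.
Qed.

(** The exponents are chosen for one tuple with finite cycles and serve for all
tuples of the class. The bound [size w <= m] makes the convergence uniform in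
the word: [K] depends on [g] and [a] but not on [w]. *)
Lemma similarity_class_conjugate_powers f i (r : M -> nat) :
  injective r ->
  (exists2 g, similarity_class f g & finite_orbits (g i)) ->
  exists N : nat -> nat, (forall m, 0 < N m)%N /\
    forall g a, similarity_class f g -> exists K, forall m w,
      (K <= m)%N -> (size w <= m)%N ->
      word_value g (conjugate_power i (N m) w) a = a.
Proof.
move=> r_inj [g fg /(uniform_exponents r_inj)[N [N0 NP]]].
exists N; split=> // g' a fg'.
have [B Bfin BP] := similarity_class_word_fix a fg fg'.
have : \forall m \near \oo, forall x, B x -> (r x <= m)%N.
  apply: (filter_finite_forall (P := fun x m => (r x <= m)%N)) => // x _.
  by exists (r x).
case=> K _ KP; exists K => m w Km wm; apply: BP => x Bx.
by apply: NP => //; exact: KP.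
Qed.

End Similarity.

(** * Algebraic closure and free extension of automorphisms *)

Section AlgebraicClosure.
Local Open Scope group_scope.
Context {L : language} {M : structure L}.
Implicit Types (A B C : set M) (g h : aut M).

Lemma subset_algebraic_closure A : A `<=` algebraic_closure A.
Proof.
move=> x Ax; apply: sub_finite_set (finite_set1 x) => _ [g gA <-].
exact: gA.
Qed.

Lemma algebraic_closureS A B :
  A `<=` B -> algebraic_closure A `<=` algebraic_closure B.
Proof.
move=> AB x; apply: sub_finite_set => _ [g gB <-].
by exists g => // a /AB; exact: gB.
Qed.

(** The orbit of [x] over [A] is a union of translates of its orbit over
[A `|` [set c]], with one translate for each point of the orbit of [c] over
[A]. *)
Lemma algebraic_closure_adjoin1 A c :
  algebraic_closure A c ->
  algebraic_closure (A `|` [set c]) `<=` algebraic_closure A.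
Proof.
move=> Ac x Acx; rewrite /algebraic_closure /=.
have /choice[t tP] c' : exists t : aut M,
    (exists2 g, pointwise_stabilizer A g & g c = c') ->
    pointwise_stabilizer A t /\ t c = c'.
  have [[g gA gc]|no] :=
      pselect (exists2 g, pointwise_stabilizer A g & g c = c').
    by exists g.
  (* No element of the stabilizer maps [c] to [c']: any value will do. *)
  by exists 1 => /no.
apply: sub_finite_set (bigcup_finite Ac (F := fun c' =>
  t c' @` [set (g : aut M) x | g in pointwise_stabilizer (A `|` [set c])]) _).
  move=> _ [g gA <-]; exists (g c); first by exists g.
  have [tA tc] : pointwise_stabilizer A (t (g c)) /\ t (g c) c = g c.
    by apply: tP; exists g.
  exists ((aut_inv (t (g c)) * g) x); last by rewrite /= aut_invVK.
  exists (aut_inv (t (g c)) * g) => // y [Ay|->].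
    by rewrite -[LHS]/(aut_inv _ (g y)) (gA y Ay) -{1}(tA y Ay) aut_invK.
  by rewrite -[LHS]/(aut_inv _ (g c)) -{2}tc aut_invK.
by move=> c' _; exact: finite_image.
Qed.

Lemma algebraic_closure_adjoin A B :
  finite_set B -> B `<=` algebraic_closure A ->
  algebraic_closure (A `|` B) `<=` algebraic_closure A.
Proof.
move=> /(@finite_seqP {classic M})[s ->]; elim: s => [|c s IH] sA.
  by apply: algebraic_closureS => x [].
have {}IH : algebraic_closure (A `|` [set` s]) `<=` algebraic_closure A.
  by apply: IH => x xs; apply: sA; rewrite /= inE xs orbT.
apply: subset_trans IH; apply: subset_trans (algebraic_closure_adjoin1 _).
  apply: algebraic_closureS => x [Ax|]; first by left; left.
  by rewrite /= inE => /orP[/eqP ->|xs]; [right|left; right].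
apply: (@algebraic_closureS A) => [x|]; first by left.
by apply: sA; rewrite /= inE eqxx.
Qed.

Lemma algebraic_closure_idem A :
  finite_set (algebraic_closure A) ->
  algebraic_closure (algebraic_closure A) `<=` algebraic_closure A.
Proof.
move=> Afin x Ax; apply: (algebraic_closure_adjoin Afin) => //.
by apply: algebraic_closureS Ax => y; right.
Qed.

(** The automorphisms that agree with [h] on [A] are the products [h * k] with [k]
fixing [A] pointwise, and the images of [c] under these [k] form an infinite
set. *)
Lemma aut_redirect h A c B :
  ~ algebraic_closure A c -> finite_set B ->
  exists g : aut M, (forall x, A x -> g x = h x) /\ ~ B (g c).
Proof.
move=> nAc Bfin; apply: contrapT => no; apply: nAc.
apply: sub_finite_set (finite_image (aut_inv h) Bfin) => _ [k kA <-].
exists (h (k c)); last exact: aut_invK.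
apply: contrapT => nB; apply: no; exists (h * k); split=> // x Ax /=.
by rewrite kA.
Qed.

Lemma iter_eq_on g h A c m :
  (forall x, A x -> g x = h x) ->
  (forall l, (l < m)%N -> A (iter l h c)) ->
  forall l, (l <= m)%N -> iter l g c = iter l h c.
Proof.
move=> gh Ah; elim=> [|l IH] //= lm.
by rewrite IH ?(ltnW lm) // gh //; exact: Ah.
Qed.

(** The iterates of [c] are redirected one after the other, each time by a change
that preserves the path already chosen. Keeping every new iterate out of the
algebraic closure of [A] and of the previous iterates both prevents the path
from returning and allows it to be redirected again. *)
Lemma aut_free_iterate (acl_finite : forall A : set M,
    finite_set A -> finite_set (algebraic_closure A)) h A c m :
  finite_set A -> ~ algebraic_closure A c ->
  exists2 g : aut M, (forall x, A x -> g x = h x) &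
    ~ algebraic_closure (A `|` [set iter l g c | l in `I_m]) (iter m g c).
Proof.
move=> Afin nAc; elim: m => [|m [h' h'A nh']].
  by exists h => //; apply: contra_not nAc; apply: algebraic_closureS => x [|[]].
set D := A `|` _ in nh'.
have Dfin : finite_set D.
  by rewrite finite_setU; split=> //; apply: finite_image; exact: finite_II.
have D'fin : finite_set (D `|` [set iter m h' c]).
  by rewrite finite_setU; split=> //; exact: finite_set1.
have [g [gD ng]] := aut_redirect h' nh' (acl_finite _ D'fin).
have gh' l : (l <= m)%N -> iter l g c = iter l h' c.
  by apply: iter_eq_on gD _ _ => k km; right; exists k.
exists g => [x Ax|]; first by rewrite gD ?h'A //; left.
rewrite iterS gh' //; apply: contra_not ng; apply: algebraic_closureS.
move=> x [Ax|[l /= lm <-]]; first by left; left.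
rewrite gh' //; move: lm; rewrite ltnS leq_eqVlt => /predU1P[->|lm].
  by right.
by left; right; exists l.
Qed.

End AlgebraicClosure.

Section Escape.
Context {L : language} {M : structure L} {n : nat}.
Implicit Types (g h : 'I_n -> aut M) (A B C : set M).

Definition word_orbit h (a : M) : set M := range (fun w => word_value h w a).

(** The conclusion is about the first exit from [C] along the path of [a]. Before
it, the path stays in [C] and is determined by the restriction to [C]. If the
exit letter is a generator, so is the exit point; if it is the inverse of the
generator [i], the exit point is determined once the value of the generator [i]
at that point is also prescribed. The index [i0] serves when [a] itself lies
outside [C]. *)
Lemma word_exit h (i0 : 'I_n) C a w :
  ~ C (word_value h w a) ->
  exists w' i, ~ C (word_value h w' a) /\
    forall g, cylinder h C g -> g i (word_value h w' a) = h i (word_value h w' a) ->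
      word_value g w' a = word_value h w' a.
Proof.
move=> nCw; apply: contrapT => no.
(* Without an exit, all paths stay in [C]. *)
suff : forall w, C (word_value h w a) /\
    forall g, cylinder h C g -> word_value g w a = word_value h w a.
  by move=> /(_ w)[].
elim=> {w nCw} [|[i b] w [Cd IH]].
  split=> //; apply: contrapT => nC; apply: no.
  by exists [::], i0.
set d := word_value h w a in Cd IH.
pose e := word_value h ((i, b) :: w) a.
have det g : cylinder h C g -> g i e = h i e ->
    word_value g ((i, b) :: w) a = e.
  move=> gC gie.
  rewrite -[LHS]/(letter_value g (i, b) (word_value g w a)) IH //.
  rewrite /e -[RHS]/(letter_value h (i, b) d).
  case: b @e gie => e; rewrite /letter_value /= => gie; first exact: gC.
  have he : h i e = d by exact: aut_invVK.
  rewrite -[LHS]/(aut_inv (g i) d) -[RHS]/(aut_inv (h i) d).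
  by rewrite -{1}he -gie aut_invK.
have Ce : C e.
  by apply: contrapT => nC; apply: no; exists ((i, b) :: w), i.
by split=> // g gC; apply: det => //; exact: gC.
Qed.

(** The word [w] depends on [h], [B], [a] and [i] but not on [N]: this is
what allows [N] to be an exponent depending on the length of [w]. Beyond the
exit point [c], controlled by generator [k], the path continues with a
generator [j] different from [k] to a point outside the algebraic closure of
everything prescribed so far, from which the iterates of the generator [i] are
free. *)
Lemma escape (acl_finite : forall A : set M,
    finite_set A -> finite_set (algebraic_closure A)) h B a (i : 'I_n) :
  (1 < n)%N -> finite_set B -> infinite_set (word_orbit h a) ->
  exists w, forall N, (0 < N)%N -> exists2 g, cylinder h B g &
    iter N (g i) (word_value g w a) <> word_value g w a.
Proof.
move=> n1 Bfin orb_inf.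
pose C := algebraic_closure B; have Cfin : finite_set C := acl_finite _ Bfin.
have [w nCw] : exists w, ~ C (word_value h w a).
  apply: contrapT => no; apply: orb_inf; apply: sub_finite_set Cfin => _ [w _ <-].
  by apply: contrapT => nCw; apply: no; exists w.
have [{nCw}w' [k [nCc det]]] := word_exit i nCw; set c := word_value h w' a in nCc det.
have [j jk] : exists j : 'I_n, j != k.
  have [k0|k0] := eqVneq (val k) 0%N.
    by exists (Ordinal n1); rewrite -val_eqE /= k0.
  by exists (Ordinal (ltnW n1)); rewrite -val_eqE /= eq_sym.
(* Prescribing the tuple on [D] fixes the whole path from [a] to [c]. *)
pose D := C `|` [set c].
have Dfin : finite_set D by rewrite finite_setU; split=> //; exact: finite_set1.
have nCc' : ~ algebraic_closure C c.
  by apply: contra_not nCc; exact: algebraic_closure_idem.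
have [u [uC nDu]] := aut_redirect (h j) nCc' (acl_finite _ Dfin).
exists ((j, true) :: w') => N N0.
(* [h'] sends [c] to a free point; [g] then has free iterates from there. *)
pose h' t := if t == j then u else h t.
have [v vD nv] := aut_free_iterate acl_finite (h' i) N Dfin nDu.
pose g t := if t == i then v else h' t.
have gh' t x : D x -> g t x = h' t x.
  by move=> Dx; rewrite /g; case: eqVneq => [->|//]; exact: vD.
have gC : cylinder h C g.
  move=> t x Cx; rewrite gh'; last by left.
  by rewrite /h'; case: eqVneq => [->|//]; exact: uC.
exists g; first by move=> t x Bx; apply: gC; exact: subset_algebraic_closure.
have gc : word_value g w' a = c.
  apply: det => //; rewrite gh'; last by right.
  by rewrite /h' eq_sym (negbTE jk).
have -> : word_value g ((j, true) :: w') a = u c.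
  rewrite -[LHS]/(g j (word_value g w' a)) gc gh'; last by right.
  by rewrite /h' eqxx.
have -> : g i = v by rewrite /g eqxx.
move=> vu; apply: nv; rewrite vu; apply: subset_algebraic_closure.
by right; exists 0%N.
Qed.

End Escape.

(** * Extending partial automorphisms *)

Section Structures.
Context {L : language}.
Implicit Types (A B M : structure L).

Lemma generated_substructure_closed M (S : set M) :
  substructure (generated_substructure S).
Proof. by move=> s x Sx T TS; case: (TS) => + _; apply=> i; exact: Sx. Qed.

Lemma subset_generated_substructure M (S : set M) :
  S `<=` generated_substructure S.
Proof. by move=> x Sx T [_]; apply. Qed.

Lemma aut_generated_substructure M (u : aut M) (S : set M) :
  (forall x, S x -> S (u x)) ->
  forall x, generated_substructure S x -> generated_substructure S (u x).
Proof.
move=> uS x /(_ (u @^-1` generated_substructure S)); apply.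
split=> [s y Sy|y Sy] /=.
  have [_ [_ ->]] := aut_funP u; last by [].
  exact: generated_substructure_closed.
by apply: subset_generated_substructure; exact: uS.
Qed.

Definition induced_structure M (S : set M) (Ssub : substructure S) :=
  @Structure L {x : M | S x} (fun r x => interp_rel M r (sval \o x))
    (fun s x => exist S _ (Ssub s (sval \o x) (fun i => svalP (x i)))).

Lemma sval_injective (T : Type) (S : set T) : injective (@sval T S).
Proof.
move=> [x Sx] [y Sy] /= xy; subst y; congr exist; exact: Prop_irrelevance.
Qed.

Lemma sval_embedding M (S : set M) (Ssub : substructure S) :
  embedding (sval : induced_structure Ssub -> M).
Proof. by split; [exact: sval_injective|split]. Qed.

Lemma induced_finite M (S : set M) (Ssub : substructure S) :
  finite_set S -> finite_set [set: induced_structure Ssub].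
Proof.
move=> Sfin; rewrite (_ : setT = (sval : induced_structure Ssub -> M) @^-1` S).
  by apply: finite_preimage Sfin => x y _ _; exact: sval_injective.
by apply/seteqP; split=> -[].
Qed.

Lemma induced_in_age M (S : set M) (Ssub : substructure S) :
  finite_set S -> in_age M (induced_structure Ssub).
Proof.
by move=> Sfin; split; [exact: induced_finite|exists sval; exact: sval_embedding].
Qed.

Lemma embedding_comp A B M (e : A -> B) (e' : B -> M) :
  embedding e -> embedding e' -> embedding (e' \o e).
Proof.
move=> [e_inj [eR eF]] [e'_inj [e'R e'F]]; split; first exact: inj_comp.
split=> [r x _|s x _]; last by rewrite /= eF // e'F.
by rewrite eR // e'R.
Qed.

Lemma aut_embedding M (u : aut M) : embedding u.
Proof. by have [/bij_inj] := aut_funP u. Qed.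

Lemma preserves_on_embedding A M (D : set A) (Dsub : substructure D)
    (p : A -> M) :
  {in D &, injective p} -> preserves_on D p ->
  embedding (p \o (sval : induced_structure Dsub -> A)).
Proof.
move=> p_inj [pR pF]; split=> [[x Dx] [y Dy] /= /p_inj e|].
  by apply: sval_injective; apply: e; exact/mem_set.
split=> [r x _|s x _].
  exact: (pR r (sval \o x) (fun i => svalP (x i))).
exact: (pF s (sval \o x) (fun i => svalP (x i))).
Qed.

Lemma aut_restrict M (u : aut M) (S : set M) (Ssub : substructure S) :
  (forall x, S x -> S (u x)) -> (forall x, S x -> S (aut_inv u x)) ->
  exists k : aut (induced_structure Ssub), forall b, sval (k b) = u (sval b).
Proof.
move=> uS uVS.
pose k (b : induced_structure Ssub) : induced_structure Ssub :=
  exist _ (u (sval b)) (uS _ (svalP b)).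
pose k' (b : induced_structure Ssub) : induced_structure Ssub :=
  exist _ (aut_inv u (sval b)) (uVS _ (svalP b)).
have [_ [uR uF]] := aut_funP u.
suff Pk : automorphism k by exists (Aut Pk).
split.
  by exists k' => b; apply: sval_injective; rewrite /= ?aut_invK ?aut_invVK.
split=> [r x _|s x _]; first exact: (uR r (sval \o x)).
by apply: sval_injective; exact: (uF s (sval \o x)).
Qed.

(** This form of ultrahomogeneity suits abstract members of the age: the map [q]
that matches the two images of [A] is a partial automorphism of [M]. *)
Lemma ultrahomogeneous_embeddings M A (e e' : A -> M) :
  ultrahomogeneous M -> finite_set [set: A] -> embedding e -> embedding e' ->
  exists u : aut M, forall a, u (e a) = e' a.
Proof.
move=> M_uh Afin [e_inj [eR eF]] [e'_inj [e'R e'F]].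
have /choice[q qP] x : exists y, forall a, e a = x -> y = e' a.
  have [[a <-]|no] := pselect (exists a, e a = x).
    by exists (e' a) => b /e_inj ->.
  by exists x => a ea; case: no; exists a.
have qe a : q (e a) = e' a by exact: qP.
have range_sub (f : A -> M) : embedding f -> substructure (range f).
  move=> [_ [_ fF]] s x /= fx.
  have /choice[y yP] i : exists a, f a = x i by have [a _ <-] := fx i; exists a.
  rewrite (_ : x = f \o y); last by apply/funext => i /=; rewrite yP.
  by rewrite -fF //; exists (interp_fun A s y).
have partial_q : partial_automorphism (range e) (range e') q.
  split; try exact: range_sub.
    split=> [_ [a _ <-]|x y|_ [a _ <-]].
    - by rewrite qe; exists a.
    - by rewrite !inE => -[a _ <-] [b _ <-]; rewrite !qe => /e'_inj ->.
    - by exists (e a); [exists a|exact: qe].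
  have eP m (x : 'I_m -> M) : (forall i, range e (x i)) -> exists y, x = e \o y.
    move=> ex.
    have /choice[y yP] i : exists a, e a = x i by have [a _ <-] := ex i; exists a.
    by exists y; apply/funext => i /=; rewrite yP.
  have qey m (y : 'I_m -> A) : q \o (e \o y) = e' \o y.
    by apply/funext => i /=.
  split=> [r x /eP[y ->]|s x /eP[y ->]]; rewrite qey -?eR // -?e'R //.
  by rewrite -eF // qe e'F.
have [||u uP] := M_uh _ _ _ _ _ partial_q; try exact: finite_image.
by exists u => a; rewrite uP //; exists a.
Qed.

Lemma ultrahomogeneous_partial M A (e : A -> M) (D E : set A) (p : A -> A) :
  ultrahomogeneous M -> finite_set [set: A] -> embedding e ->
  partial_automorphism D E p ->
  exists u : aut M, forall x, D x -> u (e x) = e (p x).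
Proof.
move=> M_uh Afin emb_e [Dsub _ [_ p_inj _] p_pres].
have Dfin : finite_set [set: induced_structure Dsub].
  by apply: induced_finite; apply: sub_finite_set Afin.
have [u uP] := ultrahomogeneous_embeddings M_uh Dfin
  (embedding_comp (sval_embedding Dsub) emb_e)
  (embedding_comp (preserves_on_embedding Dsub p_inj p_pres) emb_e).
by exists u => x Dx; exact: (uP (exist D x Dx)).
Qed.

End Structures.

Section Hrushovski.
Context {L : language} {M : structure L}.

(** Density of the automorphisms with a finite cycle at [x]. The restriction of [u]
to the substructure generated by [B] is a partial automorphism of a finite
substructure containing [x]; it extends to an automorphism [k] of a finite [B'],
and [v] is an extension of [k] transported back into [M]. Since [B'] is finite,
the cycle of [x] is finite. *)
Lemma hrushovski1_periodic (u : aut M) (B : set M) (x : M) :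
  locally_finite M -> ultrahomogeneous M -> n_hrushovski M 1 ->
  finite_set B ->
  exists v : aut M, (forall b, B b -> v b = u b) /\
    exists2 N, (0 < N)%N & iter N v x = x.
Proof.
move=> M_lf M_uh M_hr Bfin.
pose D := generated_substructure B.
have Dfin : finite_set D by exact: M_lf.
pose S := generated_substructure (D `|` u @` D `|` [set x]).
have Sfin : finite_set S.
  by apply: M_lf; rewrite !finite_setU; split=> //; split=> //; exact: finite_image.
have Ssub : substructure S by exact: generated_substructure_closed.
have DS d : D d -> S d.
  by move=> Dd; apply: subset_generated_substructure; left; left.
have uDS d : D d -> S (u d).
  by move=> Dd; apply: subset_generated_substructure; left; right; exists d.
pose A := induced_structure Ssub.
have [_ [uR uF]] := aut_funP u.
have /choice[p pP] (a : A) : exists b : A, D (sval a) -> sval b = u (sval a).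
  have [Da|nDa] := pselect (D (sval a)); last by exists a.
  by exists (exist S _ (uDS _ Da)).
pose DA : set A := [set a | D (sval a)].
pose EA : set A := [set a | (u @` D) (sval a)].
have svalp m (y : 'I_m -> A) : (forall i, DA (y i)) ->
    sval \o (p \o y) = u \o (sval \o y).
  by move=> Dy; apply/funext => i /=; rewrite pP //; exact: Dy.
have partial_p : partial_automorphism DA EA p.
  split.
  - by move=> s y Dy; apply: generated_substructure_closed.
  - move=> s y Ey.
    have /choice[z zP] i : exists d, D d /\ u d = sval (y i).
      by have [d ? ?] := Ey i; exists d.
    exists (interp_fun M s z).
      by apply: generated_substructure_closed => i; have [] := zP i.
    rewrite uF //=; congr interp_fun.
    by apply/funext => i /=; have [] := zP i.
  - split=> [a Da|a b|b [d Dd db]].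
    + by exists (sval a) => //; rewrite pP.
    + rewrite !inE => Da Db /(congr1 sval); rewrite !pP // => /(can_inj (aut_invK u)).
      exact: sval_injective.
    + exists (exist S _ (DS _ Dd)) => //; apply: sval_injective.
      by rewrite pP.
  - split=> [r y Dy|s y Dy].
      by rewrite /= svalp // -uR.
    apply: sval_injective; rewrite pP; last exact: generated_substructure_closed.
    by rewrite /= uF // svalp.
have [B' [e [[B'fin [j emb_j]] emb_e /(_ ord0)[k kP]]]] :=
  M_hr A (induced_in_age Ssub Sfin) (fun=> DA) (fun=> EA) (fun=> p)
    (fun=> partial_p).
have Afin : finite_set [set: A] by exact: induced_finite.
have [c cP] := ultrahomogeneous_embeddings M_uh Afin (sval_embedding Ssub)
  (embedding_comp emb_e emb_j).
have [t tP] := ultrahomogeneous_embeddings M_uh B'fin emb_j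
  (embedding_comp (aut_embedding k) emb_j).
(* [t] extends the copy of [k] on the image of [j], and [c] moves the structure
   [A] into this image. *)
pose v := aut_mul (aut_inv c) (aut_mul t c).
have vE y : v y = aut_inv c (t (c y)) by [].
exists v; split=> [b Bb|].
  have Db : D b by exact: subset_generated_substructure.
  pose a : A := exist S b (DS _ Db).
  rewrite vE (cP a) /= tP /= kP // -[j _]/((j \o e) (p a)) -cP pP //.
  exact: aut_invK.
have Sx : S x by apply: subset_generated_substructure; right.
pose a : A := exist S x Sx.
have [N N0 kN] : exists2 N, (0 < N)%N & iter N k (e a) = e a.
  by apply: injective_iter_periodic B'fin _ _ => //; exact: can_inj (aut_invK k).
exists N => //.
have -> m : iter m v x = aut_inv c (iter m t (c x)).
  by elim: m => [|m IH] /=; rewrite ?aut_invK // IH aut_invVK.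
have tj m b : iter m t (j b) = j (iter m k b).
  by elim: m => //= m ->; exact: tP.
by rewrite (cP a) /= tj kN -[j _]/((j \o e) a) -cP aut_invK.
Qed.

(** The witness is an extension problem without solution, realized inside [M] by a
tuple [h] of automorphisms and a finite substructure [S]. If a tuple [g]
agreeing with [h] on [S] had only finite orbits there, they would generate a
finite substructure invariant under [g], solving the problem. *)
Lemma not_hrushovski_infinite_orbits n :
  locally_finite M -> ultrahomogeneous M -> ~ n_hrushovski M n ->
  exists (h : 'I_n -> aut M) S, finite_set S /\
    forall g, cylinder h S g -> exists2 a, S a & infinite_set (word_orbit g a).
Proof.
move=> M_lf M_uh nhr; apply: contrapT => no; apply: nhr => A [Afin [e emb_e]] D E p pP.
have /choice[h hP] i := ultrahomogeneous_partial M_uh Afin emb_e (pP i).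
have Sfin : finite_set (range e) by exact: finite_image.
have [g [gh gfin]] : exists g, cylinder h (range e) g /\
    forall a, range e a -> finite_set (word_orbit g a).
  apply: contrapT => nog; apply: no; exists h, (range e); split=> // g gh.
  apply: contrapT => noa; apply: nog; exists g; split=> // a Sa.
  by apply: contrapT => ninf; apply: noa; exists a.
pose O := \bigcup_(a in range e) word_orbit g a.
pose T := generated_substructure O.
have Tfin : finite_set T by apply: M_lf; exact: bigcup_finite.
have Tsub : substructure T by exact: generated_substructure_closed.
have O_letter s x : O x -> O (letter_value g s x).
  by move=> [a Sa [w _ <-]]; exists a => //; exists (s :: w).
have TgV i x : T x -> T (g i x).
  by apply: aut_generated_substructure => y; exact: (O_letter (i, true)).
have TgVV i x : T x -> T (aut_inv (g i) x).
  by apply: aut_generated_substructure => y; exact: (O_letter (i, false)).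
have eT a : T (e a).
  apply: subset_generated_substructure; exists (e a); first by exists a.
  by exists [::].
pose e' (a : A) : induced_structure Tsub := exist T (e a) (eT a).
exists (induced_structure Tsub), e'; split; first exact: induced_in_age.
  have [e_inj [eR eF]] := emb_e.
  split=> [a b /(congr1 sval)/e_inj //|]; split=> [r x _|s x _]; first exact: eR.
  by apply: sval_injective; exact: eF.
move=> i; have [k kP] := aut_restrict Tsub (TgV i) (TgVV i).
exists k => x Dx; apply: sval_injective.
by rewrite kP /= gh ?hP //; exists x.
Qed.

End Hrushovski.

(** * Similarity classes *)

Lemma comeagerS (T : topologicalType) (A B : set T) :
  A `<=` B -> comeager A -> comeager B.
Proof.
move=> AB [N N0 AN]; exists (fun k => N k `&` ~` B) => [k|].
  rewrite /nowhere_dense -subset0 -(N0 k).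
  by apply: interiorS; apply: closureS => x [].
rewrite -setI_bigcupl -AN setIidr //; exact: subsetC.
Qed.

Section DiagonalOrbits.
Local Open Scope group_scope.
Context {G : topGroupType} {n : nat}.
Implicit Types (f : 'I_n -> G).

Definition conjugation (g x : G) : G := g * x * g^-1.

Lemma conjugationM g x y :
  conjugation g (x * y) = conjugation g x * conjugation g y.
Proof. by rewrite /conjugation !mulgA mulgVK. Qed.

Lemma conjugationK g : cancel (conjugation g) (conjugation g^-1).
Proof. by move=> x; rewrite /conjugation invgK !mulgA mulVg mul1g mulgVK. Qed.

Lemma conjugation_continuous g : continuous (conjugation g).
Proof.
move=> x; apply: (@continuous2_cvg _ _ _ _ _ _ _ _ (fun x y : G => x * y)).
- exact: (mulg_continuous (g * x, g^-1)).
- apply: (@continuous2_cvg _ _ _ _ _ _ _ _ (fun x y : G => x * y)).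
  + exact: (mulg_continuous (g, x)).
  + exact: cvg_cst.
  + exact: cvg_id.
- exact: cvg_cst.
Qed.

Lemma conjugation_generated f g x : generated_subgroup f x ->
  generated_subgroup (fun i => conjugation g (f i)) (conjugation g x).
Proof.
move=> fx H [[H1 HM HV] fH]; apply: (fx (conjugation g @^-1` H)); split.
  split=> [|y z Hy Hz|y Hy] /=.
  - by rewrite /conjugation mulg1 mulgV.
  - by rewrite conjugationM; exact: HM.
  - by have := HV _ Hy; rewrite /conjugation !invgM invgK mulgA.
by move=> _ [i _ <-]; apply: fH; exists i.
Qed.

Lemma diagonal_orbit_similar f : diagonal_orbit f `<=` similarity_class f.
Proof.
move=> _ [g ->]; exists (conjugation g) => //.
have gK x : conjugation g (conjugation g^-1 x) = x.
  by rewrite -{1}(invgK g) conjugationK.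
split.
- split=> [x|x y _ _ xy|x fx].
  + exact: conjugation_generated.
  + exact: (can_inj (conjugationK g) xy).
  + exists (conjugation g^-1 x) => //.
    have := conjugation_generated (g := g^-1) fx.
    rewrite [X in generated_subgroup X](_ : _ = f) //.
    by apply/funext => i; exact: conjugationK.
- by move=> x y _ _; exact: conjugationM.
- exact/continuous_subspaceT/conjugation_continuous.
- exists (conjugation g^-1) => [x _|]; first exact: conjugationK.
  exact/continuous_subspaceT/conjugation_continuous.
Qed.

End DiagonalOrbits.

Section SimilarityClasses.
Context {L : language} {M : structure L}.

(** Baire category applied to the dense open sets of tuples whose [i]-th coordinate
has a finite cycle at a given point. *)
Lemma comeager_meets_finite_orbits n (i : 'I_n) (r : M -> nat)
    (A : set {ptws 'I_n -> aut M}) :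
  locally_finite M -> ultrahomogeneous M -> n_hrushovski M 1 ->
  injective r -> comeager A ->
  exists2 g, A g & finite_orbits (g i).
Proof.
move=> M_lf M_uh M_hr r_inj [N N0 AN].
(* At most one point has rank [k], so each [D k] handles one point. *)
pose D k : set ('I_n -> aut M) := [set g | ~ N k g /\
  forall x, r x = k -> exists2 m, (0 < m)%N & iter m (g i) x = x].
have [||g _ gD] := @cylinder_Baire _ _ _ r D (fun=> aut_one) set0 r_inj.
- exact: finite_set0.
- move=> k g B Bfin _.
  have [g1 [B1 [B1fin g1g g1N]]] := nowhere_dense_cylinder g (N0 k) Bfin.
  have [[x xk]|nox] := pselect (exists x, r x = k); last first.
    exists g1, B1; split=> // g2 g12; split; first exact: g1N.
    by move=> x xk; case: nox; exists x.
  have [v [vB [m m0 vm]]] :=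
    hrushovski1_periodic (g1 i) x M_lf M_uh M_hr B1fin.
  pose g2 t := if t == i then v else g1 t.
  pose B2 := B1 `|` [set iter l v x | l in `I_m].
  have g12 : cylinder g2 B2 `<=` cylinder g1 B1.
    apply: subset_cylinder => [t y By|y]; last by left.
    by rewrite /g2; case: eqVneq => // ->; rewrite vB.
  exists g2, B2; split.
  + by rewrite finite_setU; split=> //; apply: finite_image; exact: finite_II.
  + exact: subset_trans g12 g1g.
  move=> g3 g23; split; first exact/g1N/g12.
  move=> y; rewrite -xk => /r_inj ->; exists m => //.
  rewrite -{2}vm; apply: (@iter_eq_on _ _ (g3 i) v B2) (leqnn m).
    by move=> z Bz; rewrite g23 // /g2 eqxx.
  by move=> l lm; right; exists l.
exists g; last by move=> x; have [_] := gD (r x); exact.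
apply: contrapT => nA; have : (~` A) g by [].
by rewrite AN => -[k _]; have [] := gD k.
Qed.

(** If the class were comeager, a generic tuple of the cylinder [cylinder h S] would
belong to it and satisfy [stable K] for no [K], since the failure of [stable K]
is open by [word_value_local] and dense in this cylinder by [escape]; but every
tuple of the class satisfies [stable K] for a large [K]. *)
Lemma similarity_class_not_comeager n (f : 'I_n -> aut M) :
  countable [set: M] -> locally_finite M -> ultrahomogeneous M ->
  (forall A : set M, finite_set A -> finite_set (algebraic_closure A)) ->
  n_hrushovski M 1 -> ~ n_hrushovski M n -> (1 < n)%N ->
  ~ comeager (similarity_class f).
Proof.
move=> /countable_injP[r /in2TT r_inj] M_lf M_uh acl_finite M_hr nhr n1 class_com.
pose i : 'I_n := Ordinal (ltnW n1).
have := comeager_meets_finite_orbits i M_lf M_uh M_hr r_inj class_com.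
move=> /(similarity_class_conjugate_powers r_inj)[e [e0 eP]].
have [h [S [Sfin hS]]] := not_hrushovski_infinite_orbits M_lf M_uh nhr.
have [N N0 classN] := class_com.
pose stable K (g : 'I_n -> aut M) a := forall m w,
  (K <= m)%N -> (size w <= m)%N -> word_value g (conjugate_power i (e m) w) a = a.
pose D k : set ('I_n -> aut M) :=
  [set g | ~ N k g /\ ~ forall a, S a -> stable k g a].
have [|g _ gD] := @cylinder_Baire _ _ _ r D h S r_inj Sfin.
- move=> k g B Bfin gh.
  have [g1 [B1 [B1fin g1g g1N]]] := nowhere_dense_cylinder g (N0 k) Bfin.
  have [g2 [g12 [a [Sa [m [w [km wm nfix]]]]]]] : exists g2,
      cylinder g1 B1 g2 /\ exists a, S a /\ exists m w,
      [/\ (k <= m)%N, (size w <= m)%N &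
          word_value g2 (conjugate_power i (e m) w) a <> a].
    have [a Sa ainf] := hS g1 (gh g1 (g1g g1 (fun _ _ _ => erefl))).
    have [w wP] := escape acl_finite i n1 B1fin ainf.
    pose m := maxn k (size w).
    have [g2 g12 nfix] := wP (e m) (e0 m).
    exists g2; split=> //; exists a; split=> //; exists m, w.
    split; [exact: leq_maxl|exact: leq_maxr|].
    by move=> /conjugate_power_fix.
  have [B2 B2fin B2P] := word_value_local g2 (conjugate_power i (e m) w) a.
  exists g2, (B1 `|` B2); split; first by rewrite finite_setU.
    by apply: subset_trans g1g; apply: subset_cylinder => // x; left.
  move=> g3 g23; split.
    by apply: g1N; apply: subset_cylinder g12 _ _ g23 => x; left.
  move=> /(_ a Sa m w km wm); rewrite B2P //.
  by move=> t x Bx; apply: g23; right.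
have fg : similarity_class f g.
  apply: contrapT => nfg; have : (~` similarity_class f) g by [].
  by rewrite classN => -[k _]; have [] := gD k.
have : \forall K \near \oo, forall a, S a -> stable K g a.
  apply: (filter_finite_forall (P := fun a K => stable K g a)) => // a _.
  have [K KP] := eP g a fg.
  by exists K => // K' /= KK' m w K'm; apply: KP; exact: leq_trans K'm.
by case=> K _ /(_ K (leqnn K)); have [] := gD K.
Qed.

End SimilarityClasses.

Theorem theorem4p7 (L : language) (M : structure L)
  (M_countable : countable [set: M])
  (M_locally_finite : locally_finite M)
  (M_ultrahomogeneous : ultrahomogeneous M)
  (M_acl_finite : forall A : set M,
     finite_set A -> finite_set (algebraic_closure A)) :
  [\/ hrushovski M,
      ~ n_hrushovski M 1
    | (exists2 n : nat, (1 <= n)%N &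
         forall f : 'I_n -> aut M, ~ comeager (similarity_class f)) /\
      ~ ample_generics (aut M)].
Proof.
have [hr|nhr] := pselect (hrushovski M); first by apply: Or31.
have [hr1|nhr1] := pselect (n_hrushovski M 1); last by apply: Or32.
apply: Or33.
have [n n_gt1 nhrn] : exists2 n, (1 < n)%N & ~ n_hrushovski M n.
  apply: contrapT => no; apply: nhr => n; rewrite leq_eqVlt => /predU1P[<- //|n1].
  by apply: contrapT => nhrn; apply: no; exists n.
have not_comeager (f : 'I_n -> aut M) : ~ comeager (similarity_class f).
  exact: similarity_class_not_comeager.
split; first by exists n; [exact: ltnW|].
move=> /(_ n (ltnW n_gt1))[h]; apply: contra_not (not_comeager h).
exact/comeagerS/diagonal_orbit_similar.
Qed.
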